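(* Let $d \geq 1$ and let $P \subset \mathbb{R}^d$ be a lattice $d$-polytope with $\operatorname{diam}_{\mathbb{Z}}(P) = 1$. Then $P$ has at most $\binom{2^d}{2}$ lattice diameter directions. This bound is best possible: for every $d \ge 1$ there exists a lattice $d$-polytope $P\subset\mathbb{R}^d$ with $\operatorname{diam}_{\mathbb{Z}}(P) = 1$ that has exactly $\binom{2^d}{2}$ lattice diameter directions.
   Context: A lattice $d$-polytope is the convex hull of finitely many points of $\mathbb{Z}^d$ whose affine hull is $d$-dimensional. The lattice diameter of a compact set $S \subset \mathbb{R}^d$ with $S\cap\mathbb{Z}^d\neq\emptyset$ is $\operatorname{diam}_{\mathbb{Z}}(S) := \max_{x,y \in S \cap \mathbb{Z}^d} |\operatorname{conv}(\{x,y\}) \cap \mathbb{Z}^d| - 1$. If $x,y$ attain this maximum, then $y - x$, or any of its non-zero multiples, is called a lattice diameter direction of $S$; directions are counted up to non-zero scalar multiples (so a direction is a one-dimensional linear subspace $\operatorname{span}(y-x)$). *)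

(* Defs.v *)
From HB Require Import structures.
From mathcomp Require Import all_boot all_order all_algebra finmap.
From mathcomp Require Import all_classical all_reals convex.

Set Implicit Arguments.
Unset Strict Implicit.
Unset Printing Implicit Defensive.

Import Order.TTheory GRing.Theory Num.Theory.

Local Open Scope classical_set_scope.
Local Open Scope ring_scope.

Definition int_lattice (R : realType) (d : nat) : set 'rV[R]_d :=
  [set x | forall j, x ord0 j \is a Num.int].

Definition conv_hull (R : realType) (d : nat) (X : set 'rV[R]_d) :
    set 'rV[R]_d :=
  smallest (@convex_set R 'rV[R]_d) X.

Definition affine_set (R : realType) (d : nat) (A : set 'rV[R]_d) : Prop :=
  forall (x y : 'rV[R]_d) (t : R), A x -> A y -> A ((1 - t) *: x + t *: y).

Definition affine_hull (R : realType) (d : nat) (X : set 'rV[R]_d) :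
    set 'rV[R]_d :=
  smallest (@affine_set R d) X.

(* A is a translate of a k-dimensional linear subspace. *)
Definition has_affine_dim (R : realType) (d : nat) (A : set 'rV[R]_d)
    (k : nat) : Prop :=
  exists (v : 'rV[R]_d) (U : {vspace 'rV[R]_d}),
    \dim U = k /\ A = [set v + u | u in [set` U]].

Definition lattice_polytope (R : realType) (d : nat) (P : set 'rV[R]_d) :
    Prop :=
  (exists V : seq 'rV[R]_d,
     [set` V] `<=` @int_lattice R d /\ P = conv_hull [set` V]) /\
  has_affine_dim (affine_hull P) d.

(* [fset_set] is meaningful only on finite sets; a segment contains only
   finitely many lattice points. For lattice points x and y there is at least
   one, so the truncated predecessor is the usual subtraction of 1. *)
Definition lattice_length (R : realType) (d : nat) (x y : 'rV[R]_d) : nat :=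
  (#|` fset_set (conv_hull [set x; y] `&` @int_lattice R d)|).-1.

Definition lattice_lengths (R : realType) (d : nat) (S : set 'rV[R]_d) :
    set nat :=
  [set n | exists x y : 'rV[R]_d,
     [/\ (S `&` @int_lattice R d) x, (S `&` @int_lattice R d) y
       & n = lattice_length x y]].

(* The maximum of [lattice_lengths S], with junk value 0 if there is none
   (which does not happen when S is compact and contains a lattice point);
   in particular a nonzero value is always an attained maximum. *)
Definition lattice_diam (R : realType) (d : nat) (S : set 'rV[R]_d) : nat :=
  xget 0%N (lattice_lengths S `&` ubound (lattice_lengths S)).

(* Directions up to nonzero scalar multiples, as one-dimensional subspaces. *)
Definition lattice_diam_directions (R : realType) (d : nat)
    (S : set 'rV[R]_d) : set {vspace 'rV[R]_d} :=
  [set L | \dim L = 1%N /\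
     exists x y : 'rV[R]_d,
       [/\ (S `&` @int_lattice R d) x, (S `&` @int_lattice R d) y,
           lattice_length x y = lattice_diam S & L = <[y - x]>%VS]].

(* Main.v *)
(* Upper bound: two distinct lattice points of P congruent mod 2 would have a
   lattice midpoint in P, contradicting diameter 1. So the lattice points of P
   inject into (Z/2)^d, and the directions into the 2-subsets of (Z/2)^d.

   Sharpness (Choi-Lam-Reznick): if all pair sums x + y of lattice points of P
   are distinct, then any two lattice points are at lattice length 1 and
   distinct pairs are never parallel. A polytope in R^(d+1) with 2^(d+1) lattice
   points and distinct pair sums is the convex hull of P x {0} and f(P) x {1},
   where f is a unimodular map moving every nonzero difference of lattice points
   of P off the set of such differences. Such an f exists only for d >= 2, so
   the induction starts from a triangle in the plane. *)
Require Import Defs.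
From mathcomp Require Import all_boot all_order all_algebra finmap.
From mathcomp Require Import all_classical all_reals.
From mathcomp Require Import interval_inference convex.
From mathcomp Require Import zify ring lra.

Set Implicit Arguments.
Unset Strict Implicit.
Unset Printing Implicit Defensive.

Import Order.TTheory GRing.Theory Num.Theory.

Local Open Scope classical_set_scope.
Local Open Scope card_scope.
Local Open Scope ring_scope.

(** * Convex hulls and the lattice points of a segment *)

Section Segments.
Variable R : realType.

(** The weight in [convex_set] is bundled with its bounds and belongs to the first point; here it is
    a plain scalar on the second point, whence the swaps of [x] and [y]. *)
Lemma convex_setP d (A : set 'rV[R]_d) :
  @convex_set R 'rV[R]_d A <->
  forall x y (t : R), 0 <= t -> t <= 1 -> A x -> A y ->
    A ((1 - t) *: x + t *: y).
Proof.
split=> [cA x y t t0 t1 Ax Ay|cA x y l].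
  have := cA y x (Itv01 t0 t1); rewrite !inE => /(_ Ay Ax).
  by move=> H; rewrite (addrC ((1 - t) *: x)); exact: H.
rewrite !inE => Ax Ay.
have H := cA y x l%:num (ge0 l) (le1 l) Ay Ax.
by rewrite (addrC ((1 - l%:num) *: y)) in H; exact: H.
Qed.

Lemma convex_conv_hull d (X : set 'rV[R]_d) (x y : 'rV[R]_d) (t : R) :
  0 <= t -> t <= 1 -> conv_hull X x -> conv_hull X y ->
  conv_hull X ((1 - t) *: x + t *: y).
Proof.
move=> t0 t1 Xx Xy A [cA XA].
by apply: (convex_setP A).1 => //; [apply: Xx|apply: Xy].
Qed.

Lemma conv_hull_sub d (X A : set 'rV[R]_d) :
  X `<=` A ->
  (forall x y (t : R), 0 <= t -> t <= 1 -> A x -> A y ->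
    A ((1 - t) *: x + t *: y)) ->
  conv_hull X `<=` A.
Proof.
move=> XA cA z; apply; split => //.
exact/convex_setP.
Qed.

Lemma conv_hull2P d (x y z : 'rV[R]_d) :
  conv_hull [set x; y] z <->
  exists2 t : R, 0 <= t <= 1 & z = (1 - t) *: x + t *: y.
Proof.
split; last first.
  by move=> [t /andP[t0 t1] ->]; apply: convex_conv_hull => //;
    apply: sub_gen_smallest; [left|right].
pose seg := [set z | exists2 t : R, 0 <= t <= 1 & z = (1 - t) *: x + t *: y].
suff : conv_hull [set x; y] `<=` seg by apply.
apply: conv_hull_sub => {z}; last first.
  move=> u v s s0 s1 [a /andP[a0 a1] ->] [b /andP[b0 b1] ->].
  exists ((1 - s) * a + s * b); first by apply/andP; split; nra.
  by apply/rowP => i; rewrite !mxE; ring.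
move=> _ [->|->]; [exists 0|exists 1];
  by rewrite ?lexx ?ler01 // ?subr0 ?subrr ?scale0r ?scale1r ?addr0 ?add0r.
Qed.

Lemma int_latticeD d (x y : 'rV[R]_d) :
  int_lattice x -> int_lattice y -> int_lattice (x + y).
Proof. by move=> hx hy j; rewrite mxE rpredD. Qed.

Lemma int_latticeB d (x y : 'rV[R]_d) :
  int_lattice x -> int_lattice y -> int_lattice (x - y).
Proof. by move=> hx hy j; rewrite !mxE rpredB. Qed.

(** A coordinate in which the endpoints differ determines a point of the segment and takes only
    finitely many integer values there. This makes the [fset_set] in [lattice_length] meaningful. *)
Lemma finite_segment_lattice d (x y : 'rV[R]_d) :
  finite_set (conv_hull [set x; y] `&` @int_lattice R d).
Proof.
have [->|/eqP xy] := eqVneq x y.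
  apply: (@sub_finite_set _ _ [set y]) => // z [/conv_hull2P[t _ ->] _].
  by rewrite /= -scalerDl subrK scale1r.
have [j xyj] : exists j, x ord0 j != y ord0 j.
  apply/existsP; apply: contra_notT xy => /existsPn h.
  by apply/rowP => j; apply/eqP; rewrite -[_ == _]negbK.
have yx0 : y ord0 j - x ord0 j != 0 by rewrite subr_eq0 eq_sym.
pose m := Num.bound (`|x ord0 j| + `|y ord0 j|).
have hm : `|x ord0 j| + `|y ord0 j| < m%:R.
  by rewrite /m archi_boundP // addr_ge0.
(* [h k] is the point of the line whose [j]-th coordinate is [k - m]; the shift by [m] turns
   integers between [-m] and [m] into naturals. *)
pose h (k : nat) :=
  x + ((k%:R - m%:R - x ord0 j) / (y ord0 j - x ord0 j)) *: (y - x).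
apply: (@sub_finite_set _ _ (h @` `I_(m + m))); last first.
  exact: finite_image.
move=> z [/conv_hull2P[t /andP[t0 t1] ->]] /(_ j).
set c := (c in c \is a _); move=> zj.
have cE : c = x ord0 j + t * (y ord0 j - x ord0 j).
  by rewrite /c !mxE; ring.
have [xl xr] : - `|x ord0 j| <= x ord0 j /\ x ord0 j <= `|x ord0 j|.
  by rewrite ler_norm lerNl -normrN ler_norm.
have [yl yr] : - `|y ord0 j| <= y ord0 j /\ y ord0 j <= `|y ord0 j|.
  by rewrite ler_norm lerNl -normrN ler_norm.
have x0 := normr_ge0 (x ord0 j); have y0 := normr_ge0 (y ord0 j).
have cl : 0 <= c + m%:R by rewrite cE; nra.
have cr : c + m%:R < (m + m)%:R by rewrite natrD cE; nra.
have : c + m%:R \is a Num.nat by rewrite natrEint cl rpredD // intr_nat.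
case/natrP => k kE; exists k => /=; first by rewrite -(ltr_nat R) -kE.
rewrite /h -kE addrK cE.
apply/rowP => i; rewrite !mxE [_ + t * _ - _]addrAC subrr add0r mulfK //.
by ring.
Qed.

End Segments.

(** * Cardinality of the set of two-element subsets *)

Lemma card_fintype (T : finType) : [set: T] #= `I_#|T|.
Proof.
rewrite (card_eqr card_II) -(card_eql (inj_card_eq (in2W (@enum_rank_inj T)))).
suff -> : enum_rank @` [set: T] = [set: 'I_#|T|] by exact: card_eqxx.
by apply/seteqP; split=> // i _; exists (enum_val i) => //; rewrite enum_valK.
Qed.

Lemma card_2subsets (T : finType) :
  [set A : {set T} | #|A| = 2%N] #= `I_('C(#|T|, 2)).
Proof.
have <- : #|[pred A : {set T} | #|A| == 2%N]| = 'C(#|T|, 2).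
  by rewrite -card_draws cardsE.
rewrite -card_sig -(card_eqr (card_fintype _)).
rewrite -(card_eqr (inj_card_eq (in2W val_inj))).
set X := (X in _ #= X); suff -> : [set A : {set T} | #|A| = 2%N] = X.
  exact: card_eqxx.
apply/seteqP; split=> [A /= /eqP hA|A [B _ <-]] /=; first by exists (Sub A hA).
exact/eqP/(valP B).
Qed.

Lemma vlineN (K : fieldType) (vT : vectType K) (v : vT) : <[- v]>%VS = <[v]>%VS.
Proof.
by apply/eqP; rewrite eqEsubv -!memvE memvN memv_line -memvN memv_line.
Qed.

(** * The upper bound, by residues modulo 2 *)

Section Parity.
Variables (R : realType) (d : nat).

(** The class of a lattice point in (Z/2)^d; on integral coordinates [Num.floor] only changes the
    type. *)
Definition parity (x : 'rV[R]_d) : {ffun 'I_d -> bool} :=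
  [ffun j => odd `|Num.floor (x ord0 j)|%N].

Lemma midpoint_int_lattice (x y : 'rV[R]_d) :
  int_lattice x -> int_lattice y -> parity x = parity y ->
  int_lattice ((1 - 2^-1) *: x + 2^-1 *: y).
Proof.
move=> hx hy /ffunP xy j; move: (xy j); rewrite !ffunE !mxE.
have /intrP[a xa] := hx j; have /intrP[b yb] := hy j.
rewrite xa yb !intrKfloor => ab.
pose c := ((a + b) %/ 2)%Z.
have abc : a + b = c * 2 by rewrite /c; lia.
have -> : (1 - 2^-1) * a%:~R + 2^-1 * b%:~R = c%:~R :> R.
  have : (a + b)%:~R = (c * 2)%:~R :> R by rewrite abc.
  by rewrite intrD intrM; lra.
exact: intr_int.
Qed.

Lemma lattice_length_parity (x y : 'rV[R]_d) :
  int_lattice x -> int_lattice y -> parity x = parity y -> x != y ->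
  (2 <= lattice_length x y)%N.
Proof.
move=> hx hy xy xNy; rewrite /lattice_length.
set m := (1 - 2^-1) *: x + 2^-1 *: y.
have mx : m - x = 2^-1 *: (y - x) by apply/rowP => i; rewrite !mxE; ring.
have my : m - y = 2^-1 *: (x - y).
  by apply/rowP => i; rewrite !mxE; field.
have half0 : 2^-1 != 0 :> R by rewrite invr_eq0 pnatr_eq0.
(* Three distinct lattice points on the segment give length at least 2, since the length is the
   count minus one. *)
suff: (size [:: x; y; m] <=
    #|` fset_set (conv_hull [set x; y] `&` @int_lattice R d)|)%N.
  by case: #|` _ |.
apply: uniq_leq_size => [|z].
  rewrite /= !inE /= andbT negb_or xNy /=.
  rewrite -subr_eq0 -opprB mx oppr_eq0 scaler_eq0 (negPf half0) subr_eq0.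
  rewrite eq_sym xNy /= -subr_eq0 -opprB my oppr_eq0 scaler_eq0.
  by rewrite (negPf half0) subr_eq0.
rewrite in_fset_set; last exact: finite_segment_lattice.
rewrite !inE => /or3P[] /eqP -> /=; split => //.
- by apply: sub_gen_smallest; left.
- by apply: sub_gen_smallest; right.
- apply/conv_hull2P; exists 2^-1 => //.
  by rewrite invr_ge0 ler0n invf_le1 ?ler1n ?ltr0n.
- exact: midpoint_int_lattice.
Qed.

(** Positivity excludes the default value 0 of [xget], so the diameter is a true maximum. *)
Lemma lattice_length_le_diam (P : set 'rV[R]_d) (x y : 'rV[R]_d) :
  (0 < lattice_diam P)%N ->
  (P `&` @int_lattice R d) x -> (P `&` @int_lattice R d) y ->
  (lattice_length x y <= lattice_diam P)%N.
Proof.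
rewrite /lattice_diam; case: xgetP => // n _ [_ ub] _ Px Py.
by apply: ub; exists x, y.
Qed.

Lemma parity_inj (P : set 'rV[R]_d) :
  lattice_diam P = 1%N ->
  {in P `&` @int_lattice R d &, injective parity}.
Proof.
move=> P1 x y; rewrite !in_setE => Px Py xy; apply/eqP/negPn/negP => xNy.
have := lattice_length_parity (proj2 Px) (proj2 Py) xy xNy.
apply/negP; rewrite -ltnNge ltnS.
by rewrite -P1 lattice_length_le_diam ?P1.
Qed.

Lemma card_lattice_diam_directions_le (P : set 'rV[R]_d) :
  lattice_diam P = 1%N -> lattice_diam_directions P #<= `I_('C(2 ^ d, 2)).
Proof.
move=> P1; have parI := parity_inj P1.
(* [f] sends a direction to the two parity classes of one chosen pair realizing it; the empty set is
   a default for other subspaces. *)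
have /choice[f fP] (L : {vspace 'rV[R]_d}) :
  exists A : {set {ffun 'I_d -> bool}},
    lattice_diam_directions P L -> exists x y,
      [/\ (P `&` @int_lattice R d) x, (P `&` @int_lattice R d) y,
        x != y, L = <[y - x]>%VS & A = [set parity x; parity y]%SET].
  have [[L1 [x [y [Px Py _ LE]]]]|DL] := pselect (lattice_diam_directions P L);
    last by exists finset.set0.
  exists [set parity x; parity y]%SET => _; exists x, y; split => //.
  apply/eqP => xy; move: L1.
  by rewrite LE xy subrr dim_vline eqxx.
have cardT : #|{ffun 'I_d -> bool}| = (2 ^ d)%N.
  by rewrite card_ffun card_bool card_ord.
rewrite -cardT -(card_le_eqr (card_2subsets _)).
suff fI : {in lattice_diam_directions P &, injective f}.
  rewrite -(card_le_eql (inj_card_eq fI)); apply: subset_card_le.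
  move=> _ [L /fP[x [y [Px Py xNy _ ->]]] <-] /=.
  rewrite cards2; case: eqP => // /parI xy.
  by rewrite xy ?in_setE // eqxx in xNy.
move=> L L'; rewrite !in_setE.
move=> /fP[x [y [Px Py xNy -> ->]]] /fP[x' [y' [Px' Py' _ -> ->]]] E.
have inj a b : (P `&` @int_lattice R d) a -> (P `&` @int_lattice R d) b ->
    parity a = parity b -> a = b.
  by move=> Pa Pb; apply: parI; rewrite in_setE.
have : parity x \in [set parity x'; parity y']%SET by rewrite -E !inE eqxx.
have : parity y \in [set parity x'; parity y']%SET.
  by rewrite -E !inE eqxx orbT.
(* The pairs agree up to order, and reversing a pair only negates the spanning vector. *)
rewrite !inE => /orP[] /eqP /inj yE /orP[] /eqP /inj xE.
- by rewrite yE // xE // eqxx in xNy.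
- by rewrite yE // xE // -opprB vlineN.
- by rewrite yE // xE.
- by rewrite yE // xE // eqxx in xNy.
Qed.

End Parity.

(** * Distinct pair sums force diameter 1 and non-parallel differences *)

Section DistinctPairSums.
Variables (R : realType) (d : nat).

(** Degenerate pairs [x = y] are included, so no point of [E] is the midpoint of two others. *)
Definition distinct_pair_sums (E : set 'rV[R]_d) :=
  forall x y z w, E x -> E y -> E z -> E w -> x + y = z + w -> x = z \/ x = w.

Variable X : set 'rV[R]_d.
Let P := conv_hull X.
Let E := P `&` @int_lattice R d.
Hypothesis dpsE : distinct_pair_sums E.

Lemma segment_lattice_points x y : E x -> E y ->
  conv_hull [set x; y] `&` @int_lattice R d = [set x; y].
Proof.
move=> [Px hx] [Py hy]; apply/seteqP; split=> [z [/conv_hull2P[t t01 zE] hz]|z];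
  last by case=> ->; split => //; apply: sub_gen_smallest; [left|right].
have [t0 t1] := andP t01.
(* The reflection of [z] in the midpoint of the segment is also in [E]. *)
have Pz : P z by rewrite zE; apply: convex_conv_hull.
have Pz' : P (x + y - z).
  have -> : x + y - z = (1 - t) *: y + t *: x.
    by rewrite zE; apply/rowP => i; rewrite !mxE; ring.
  exact: convex_conv_hull.
apply: (dpsE (y := x + y - z)) => //; last by rewrite addrC subrK.
by split => //; apply: int_latticeB => //; apply: int_latticeD.
Qed.

Lemma lattice_length_neq x y : E x -> E y -> lattice_length x y = (x != y).
Proof.
move=> Ex Ey; rewrite /lattice_length segment_lattice_points //.
have -> : fset_set [set x; y] = [fset x; y]%fset.
  by rewrite fset_setU ?fset_set1.
by rewrite cardfs2; case: (x != y).
Qed.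

Lemma lattice_diam_eq1 x y : E x -> E y -> x != y -> lattice_diam P = 1%N.
Proof.
move=> Ex Ey xNy.
have ub1 : ubound (lattice_lengths P) 1%N.
  by move=> _ [u [v [Eu Ev ->]]]; rewrite lattice_length_neq //; case: (u != v).
have in1 : lattice_lengths P 1%N.
  by exists x, y; split => //; rewrite lattice_length_neq // xNy.
rewrite /lattice_diam; case: xgetP => [n _ [n_in n_ub]|/(_ 1%N)[]//].
by apply/eqP; rewrite eqn_leq [(n <= 1)%N]ub1 //; exact: n_ub.
Qed.

Lemma parallel_same_pair x y z w : E x -> E y -> E z -> E w -> x != y ->
  z != w -> <[y - x]>%VS = <[w - z]>%VS -> (x = z /\ y = w) \/ (x = w /\ y = z).
Proof.
(* A positive ratio at most 1 turns one segment into a part of the other. *)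
have key a b u v (c : R) : E a -> E b -> E u -> E v -> a != b ->
    0 < c -> c <= 1 -> b - a = c *: (v - u) -> a = u /\ b = v.
  move=> Ea Eb Eu Ev aNb c0 c1 ab.
  (* Translated to start at [u], the shorter segment ends at a lattice point of the longer one,
     hence at [v]; then [b + u = v + a] is a coincidence of pair sums. *)
  have : (conv_hull [set u; v] `&` @int_lattice R d) (u + (b - a)).
    split; last first.
      case: Ea Eb Eu => [_ ?] [_ ?] [_ ?].
      by apply: int_latticeD => //; apply: int_latticeB.
    apply/conv_hull2P; exists c; first by rewrite ltW.
    by rewrite ab; apply/rowP => i; rewrite !mxE; ring.
  rewrite segment_lattice_points // => -[|] uba.
    move/eqP: uba; rewrite addrC -subr_eq0 addrK subr_eq0 => /eqP ba.
    by rewrite ba eqxx in aNb.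
  have ba : b + u = v + a by rewrite -uba -addrA subrK addrC.
  have [bv|ba'] := dpsE Eb Eu Ev Ea ba; last by rewrite ba' eqxx in aNb.
  by split => //; move: ba; rewrite bv => /addrI.
have key2 a b u v (c : R) : E a -> E b -> E u -> E v -> a != b ->
    `|c| <= 1 -> b - a = c *: (v - u) -> (a = u /\ b = v) \/ (a = v /\ b = u).
  move=> Ea Eb Eu Ev aNb c1 ab; have [c0|c0|c0] := ltrgt0P c.
  - by left; apply: (key _ _ _ _ c) => //; rewrite -[c]gtr0_norm.
  - right; apply: (key _ _ _ _ (- c)) => //; first by rewrite oppr_gt0.
      by rewrite -ltr0_norm.
    by rewrite ab -[v - u]opprB scalerN scaleNr.
  - by move/eqP: ab; rewrite c0 scale0r subr_eq0 eq_sym (negPf aNb).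
move=> Ex Ey Ez Ew xNy zNw L.
have /vlineP[c cE] : y - x \in <[w - z]>%VS by rewrite -L memv_line.
have [c1|c1] := leP `|c| 1; first exact: (key2 _ _ _ _ c).
have c0 : c != 0 by rewrite -normr_gt0 (lt_trans _ c1).
(* A ratio above 1 in absolute value is inverted by exchanging the two pairs. *)
have := key2 z w x y c^-1 Ez Ew Ex Ey zNw.
rewrite normfV invf_le1 ?(lt_trans _ c1) // (ltW c1) => /(_ isT).
rewrite cE scalerA mulVf // scale1r => /(_ erefl).
by case=> -[-> ->]; [left|right].
Qed.

Lemma card_lattice_diam_directions_ge (T : finType) (v : T -> 'rV[R]_d) :
  injective v -> (forall i, E (v i)) ->
  `I_('C(#|T|, 2)) #<= lattice_diam_directions P.
Proof.
move=> vI Ev; rewrite -(card_le_eql (card_2subsets T)).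
have /choice[f fP] (A : {set T}) : exists L : {vspace 'rV[R]_d},
    #|A| = 2%N -> exists i j,
      [/\ i != j, A = [set i; j]%SET & L = <[v j - v i]>%VS].
  have [/eqP/cards2P[i [j [ij AE]]]|A2] := eqVneq #|A| 2%N.
    by exists <[v j - v i]>%VS => _; exists i, j.
  by exists 0%VS => A2'; rewrite A2' in A2.
have fI : {in [set A : {set T} | #|A| = 2%N] &, injective f}.
  move=> A B; rewrite !in_setE => /fP[i [j [ij -> ->]]] /fP[k [l [kl -> ->]]].
  case/parallel_same_pair; rewrite ?(inj_eq vI) //; case=> /vI -> /vI -> //.
  by rewrite finset.setUC.
rewrite -(card_le_eql (inj_card_eq fI)); apply: subset_card_le.
move=> _ [A /fP[i [j [ij _ ->]]] <-].
have vij : v i != v j by rewrite (inj_eq vI).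
split; first by rewrite dim_vline subr_eq0 eq_sym vij.
exists (v i), (v j); split => //; try exact: Ev.
by rewrite lattice_length_neq // (lattice_diam_eq1 (Ev i) (Ev j)) // vij.
Qed.

End DistinctPairSums.

(** * Integral transvections displacing a finite set of vectors *)

Section Transvection.
Variable R : realType.

Lemma natural_nonroot (ps : seq {poly R}) :
  exists n : nat, forall p, p \in ps -> p != 0 -> p.[n%:R] != 0.
Proof.
pose q := \prod_(p <- ps | p != 0) p.
have q0 : q != 0 by rewrite prodf_seq_neq0; apply/allP => p _; apply/implyP.
have [n qn] : exists n : nat, ~~ root q n%:R.
  apply: contrapT => /forallNP h.
  (* Otherwise the first [size q] naturals would all be roots, too many for a nonzero polynomial. *)
  suff /(max_poly_roots q0) : all (root q) [seq n%:R | n <- iota 0 (size q)].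
    rewrite map_inj_uniq ?iota_uniq; last exact: mulrIn (oner_neq0 R).
    by rewrite size_map size_iota ltnn => /(_ isT).
  by apply/allP => _ /mapP[n _ ->]; apply/negPn/negP.
exists n => p pps p0; apply: contraNneq qn => pn0.
rewrite /root /q horner_prod prodf_seq_eq0; apply/hasP.
by exists p; rewrite ?p0 ?pn0 //=.
Qed.

Lemma mulmx_int_lattice m n (x : 'rV[R]_m) (M : 'M[R]_(m, n)) :
  int_lattice x -> (forall i j, M i j \is a Num.int) -> int_lattice (x *m M).
Proof. by move=> hx hM j; rewrite mxE rpred_sum // => i _; rewrite rpredM. Qed.

(** The powers of a suitable [N] define an integral form [l] that is nonzero on the nonzero vectors
    of [D]. Coordinate 1 of [u *m M] is then a nonconstant affine function of [K], so some [K]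
    avoids every [w]. Dimension at least 2 leaves room for a nonzero vector in the kernel of [l]. *)
Lemma displacing_unimodular n (D : seq 'rV[R]_n.+2) : exists M M' : 'M[R]_n.+2,
  [/\ M *m M' = 1%:M, M' *m M = 1%:M,
      forall i j, M i j \is a Num.int, forall i j, M' i j \is a Num.int &
      forall u w, u \in D -> w \in D -> u != 0 -> u *m M != w].
Proof.
have [N hN] := natural_nonroot [seq rVpoly u | u <- D].
pose c : 'cV[R]_n.+2 := \col_j N%:R ^+ j.
have lE (u : 'rV[R]_n.+2) : (u *m c) 0 0 = (rVpoly u).[N%:R].
  rewrite horner_poly mxE; apply: eq_bigr => i _.
  by rewrite !mxE valK.
pose l (u : 'rV[R]_n.+2) : R := (u *m c) 0 0.
have l0 u : u \in D -> u != 0 -> l u != 0.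
  move=> uD u0; rewrite /l lE hN ?map_f //.
  by apply: contraNneq u0 => h; rewrite -[u]rVpolyK h linear0.
(* Coordinate 1 of [u *m M - w], as a polynomial in [K]. *)
pose q (uw : 'rV[R]_n.+2 * 'rV[R]_n.+2) :=
  (uw.1 0 1 - uw.2 0 1)%:P - l uw.1 *: 'X.
have [K hK] := natural_nonroot [seq q (u, w) | u <- D, w <- D].
(* The transvection [u |-> u + K l(u) e], where [l(e) = 0]. *)
pose e : 'rV[R]_n.+2 := N%:R *: delta_mx 0 0 - delta_mx 0 1.
have ec : e *m c = 0.
  rewrite mulmxBl -scalemxAl -!rowE; apply/rowP => j.
  by rewrite ord1 !mxE expr0 expr1 mulr1 subrr.
pose B := K%:R *: (c *m e).
(* Since [B] squares to zero, [1 - B] inverts [1 + B] and is again integral. *)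
have BB : B *m B = 0.
  by rewrite -scalemxAl -scalemxAr mulmxA -(mulmxA c) ec mulmx0 mul0mx !scaler0.
have Bint i j : B i j \is a Num.int.
  rewrite !mxE rpredM ?natr_int // rpred_sum // => k _.
  by rewrite !mxE rpredM ?rpredX ?rpredB ?rpredM ?natr_int.
have int1 i j : (1%:M : 'M[R]_n.+2) i j \is a Num.int by rewrite mxE natr_int.
exists (1%:M + B), (1%:M - B); split.
- by rewrite mulmxDl !mulmxBr !mul1mx mulmx1 BB subr0 subrK.
- by rewrite mulmxBl !mulmxDr !mul1mx mulmx1 BB addr0 addrK.
- by move=> i j; rewrite mxE rpredD.
- by move=> i j; rewrite mxE [(- B) i j]mxE rpredB.
move=> u w uD wD u0; apply/eqP => uMw.
have quw : q (u, w) != 0.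
  apply/eqP => /(congr1 (fun p : {poly R} => p`_1)).
  rewrite coefB coefC coefZ coefX coef0 /= mulr1 sub0r => /eqP.
  by rewrite oppr_eq0 (negPf (l0 _ uD u0)).
have := hK _ (allpairs_f (fun u w => q (u, w)) uD wD) quw.
rewrite /q !hornerE /= -uMw.
have -> : (u *m (1%:M + B)) 0 1 = u 0 1 - K%:R * l u.
  rewrite mulmxDr mulmx1 -scalemxAr mulmxA !mxE; congr (_ + _).
  rewrite big_ord1 !mxE /= -/(l u) mulr0 sub0r /l.
  by rewrite !mxE; ring.
by rewrite opprB addrCA subrr addr0 mulrC subrr eqxx.
Qed.

End Transvection.

(** * Inductive construction of the extremal point families *)

Section Construction.
Variable R : realType.

(** The last clause encodes full dimension. Stating distinct sums on indices also makes [v]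
    injective: compare [i, i] with [j, j]. *)
Definition extremal_family (T : finType) d (v : T -> 'rV[R]_d) : Prop :=
  [/\ forall i, int_lattice (v i),
      forall i j k l, v i + v j = v k + v l -> i = k \/ i = l,
      conv_hull (range v) `&` @int_lattice R d `<=` range v &
      forall A, affine_set A -> range v `<=` A -> A = [set: 'rV[R]_d]].

Lemma extremal_family_inj (T : finType) d (v : T -> 'rV[R]_d) :
  extremal_family v -> injective v.
Proof. by move=> [_ dps _ _] i j ij; case: (dps i i j j); rewrite ?ij. Qed.

(** 0 and 1 are extreme points of the unit interval. *)
Lemma convex_comb_bool (b : bool) (t x y : R) :
  0 < t -> t < 1 -> 0 <= x <= 1 -> 0 <= y <= 1 ->
  (1 - t) * x + t * y = b%:R -> x = b%:R /\ y = b%:R.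
Proof.
move=> t0 t1 /andP[x0 x1] /andP[y0 y1].
have t'0 : 0 < 1 - t by rewrite subr_gt0.
by case: b => /= E; split; nra.
Qed.

(** Sums inside one layer stay distinct because [F b] is invertible; sums across the layers stay
    distinct because [M] displaces differences. *)
Lemma extremal_family_step (T : finType) n (v : T -> 'rV[R]_n.+2) :
  extremal_family v ->
  exists w : bool * T -> 'rV[R]_(1 + n.+2), extremal_family w.
Proof.
move=> vE; have vI := extremal_family_inj vE.
have [vint vdps vhull vaff] := vE.
pose D := codom (fun p : T * T => v p.1 - v p.2).
have DP i j : v i - v j \in D.
  exact: (codom_f (fun p : T * T => v p.1 - v p.2) (i, j)).
have [M [M' [MM' M'M Mint M'int MD]]] := displacing_unimodular D.
have disp i j k l : v i - v j = (v k - v l) *m M -> k = l.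
  move=> E; apply/eqP; rewrite -(inj_eq vI) -subr_eq0.
  apply: contraTT isT => kl.
  by have /negP := MD _ _ (DP k l) (DP i j) kl; rewrite E eqxx.
pose F (b : bool) : 'M[R]_n.+2 := if b then M else 1%:M.
pose G (b : bool) : 'M[R]_n.+2 := if b then M' else 1%:M.
have FG b : F b *m G b = 1%:M by case: b; rewrite /= ?mulmx1.
have GF b : G b *m F b = 1%:M by case: b; rewrite /= ?mulmx1.
have int1 i j : (1%:M : 'M[R]_n.+2) i j \is a Num.int by rewrite mxE natr_int.
have Fint b i j : F b i j \is a Num.int by case: b => /=.
have Gint b i j : G b i j \is a Num.int by case: b => /=.
(* The first coordinate is the height: the bottom layer is a plain copy, the top one is twisted by
   [M]. *)
pose lay (b : bool) (x : 'rV[R]_n.+2) : 'rV[R]_(1 + n.+2) :=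
  row_mx (b%:R)%:M (x *m F b).
pose w (bi : bool * T) := lay bi.1 (v bi.2).
pose h (z : 'rV[R]_(1 + n.+2)) : R := lsubmx z 0 0.
have hE (z z' : 'rV[R]_(1 + n.+2)) (s t : R) :
  h (s *: z + t *: z') = s * h z + t * h z' by rewrite /h !mxE.
have hlay b x : h (lay b x) = b%:R by rewrite /h row_mxKl mxE eqxx mulr1n.
have layK (z : 'rV[R]_(1 + n.+2)) (b : bool) :
    h z = b%:R -> lay b (rsubmx z *m G b) = z.
  move=> hz; rewrite /lay -mulmxA GF mulmx1 -hz -[RHS]hsubmxK; congr row_mx.
  by rewrite [RHS]mx11_scalar.
exists w; split.
- move=> [b i] j; rewrite /w /lay /= mxE; case: splitP => k _.
    by rewrite [k]ord1 mxE rpredMn ?natr_int.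
  exact: mulmx_int_lattice.
- move=> [b1 i1] [b2 i2] [b3 i3] [b4 i4]; rewrite /w /lay /= !add_row_mx.
  (* Comparing heights, both sides use equally many points of the top layer. *)
  move=> /eq_row_mx[/(congr1 (fun A : 'M_1 => A 0 0))].
  rewrite !mxE !eqxx !mulr1n -!natrD => /eqP; rewrite eqr_nat => /eqP bE.
  have same b : v i1 *m F b + v i2 *m F b = v i3 *m F b + v i4 *m F b ->
      i1 = i3 \/ i1 = i4.
    rewrite -!mulmxDl => /(congr1 (mulmx^~ (G b))).
    by rewrite -!mulmxA FG !mulmx1 => /vdps.
  (* Rearranged, this equates a difference with the image of a difference under [M], so both
     vanish. *)
  have mixed x1 x2 x3 x4 : v x1 + v x2 *m M = v x3 + v x4 *m M ->
      x1 = x3 /\ x2 = x4.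
    move=> E; have E' : v x1 - v x3 = (v x4 - v x2) *m M.
      rewrite mulmxBl; apply/eqP; rewrite subr_eq addrAC [_ + v x3]addrC -E.
      by rewrite addrK.
    have xE := disp _ _ _ _ E'; split => //.
    by apply: vI; move: E; rewrite xE => /addIr.
  case: b1 b2 b3 b4 bE => [] [] [] [] //= _; rewrite /F /= ?mulmx1 => E.
  + by have [->|->] := same true E; [left|right].
  + by rewrite addrC [RHS]addrC in E; have [_ ->] := mixed _ _ _ _ E; left.
  + by rewrite addrC in E; have [_ ->] := mixed _ _ _ _ E; right.
  + by rewrite [RHS]addrC in E; have [-> _] := mixed _ _ _ _ E; right.
  + by have [-> _] := mixed _ _ _ _ E; left.
  + have := same false; rewrite /F !mulmx1 => /(_ E) [->|->]; by [left|right].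
(* A convex superset constraining only the slices at heights 0 and 1, which suffices because lattice
   points have integral height. *)
- pose S := [set z | 0 <= h z <= 1 /\
    forall b : bool, h z = b%:R -> conv_hull (range v) (rsubmx z *m G b)].
  have hullS : conv_hull (range w) `<=` S.
    apply: conv_hull_sub => [_ [[b i] _ <-]|x y t t0 t1 [hx Sx] [hy Sy]].
      rewrite /w /=; split; first by rewrite hlay; case: b; rewrite !lexx ler01.
      move=> b'; rewrite hlay => /eqP; rewrite eqr_nat => /eqP bb'.
      have -> : b' = b by case: b b' bb' => [] [].
      rewrite row_mxKr -mulmxA FG mulmx1.
      by apply: sub_gen_smallest; exists i.
    split; first by rewrite hE; nra.
    move=> b; rewrite hE.
    have [->|tN0] := eqVneq t 0.
      by rewrite subr0 mul1r mul0r addr0 scale1r scale0r addr0 => /Sx.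
    have [->|tN1] := eqVneq t 1.
      by rewrite subrr mul1r mul0r add0r scale1r scale0r add0r => /Sy.
    have t0' : 0 < t by rewrite lt_def tN0.
    have t1' : t < 1 by rewrite lt_def eq_sym tN1.
    move=> /(convex_comb_bool t0' t1' hx hy)[/Sx Hx /Sy Hy].
    rewrite linearD !linearZ /= mulmxDl -!scalemxAl.
    exact: convex_conv_hull.
  move=> z [/hullS[h01 Sz] zint].
  have [b hz] : exists b : bool, h z = b%:R.
    have : h z \is a Num.int by rewrite /h mxE.
    case/andP: h01 => h0 h1; case/intrP => k hk; rewrite hk in h0 h1 *.
    rewrite ler0z in h0; rewrite -[1]/(1%:~R) ler_int in h1.
    have [->|->] : k = 0 \/ k = 1 by lia.
      by exists false.
    by exists true.
  have rint : int_lattice (rsubmx z) by move=> j; rewrite mxE.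
  have [|i _ iE] := vhull (rsubmx z *m G b).
    by split; [exact: Sz|exact: mulmx_int_lattice].
  by exists (b, i) => //; rewrite /w /= iE layK.
- move=> A Aaff wA.
  have layA b x : A (lay b x).
    suff /seteqP[_ /(_ x)] : [set y | A (lay b y)] = setT by apply.
    apply: vaff => [y z t Ay Az|_ [i _ <-]] /=;
      last by apply: wA; exists (b, i).
    have -> : lay b ((1 - t) *: y + t *: z) = (1 - t) *: lay b y + t *: lay b z.
      rewrite /lay !scale_row_mx add_row_mx mulmxDl -!scalemxAl -scalerDl.
      by rewrite subrK scale1r.
    exact: Aaff.
  apply/seteqP; split=> // z _.
  have [hz|hz] := eqVneq (h z) 1.
    by rewrite -(layK z true hz).
  have hz' : 1 - h z != 0 by rewrite subr_eq0 eq_sym.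
  (* Off height 1, [z] lies on a line through a point of the bottom hyperplane and the fixed top
     point [lay true 0]. *)
  have -> : z = (1 - h z) *: lay false ((1 - h z)^-1 *: rsubmx z)
      + h z *: lay true 0.
    rewrite /lay !scale_row_mx add_row_mx mulmx1 mul0mx scaler0 addr0 scalerA.
    rewrite mulfV // scale1r -[LHS]hsubmxK; congr row_mx.
    rewrite scale_scalar_mx [LHS]mx11_scalar; apply/rowP => i.
    by rewrite !mxE [i]ord1 eqxx !mulr1n mulr0 add0r mulr1 /h mxE.
  exact: Aaff.
Qed.

(** The unit segment, treated apart because the inductive step starts from dimension 2. *)
Lemma extremal_family_dim1 :
  exists v : bool -> 'rV[R]_1, extremal_family v.
Proof.
pose v (b : bool) : 'rV[R]_1 := const_mx b%:R.
have vP (z : 'rV[R]_1) (b : bool) : z ord0 ord0 = b%:R -> z = v b.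
  by move=> zb; apply/rowP => i; rewrite ord1 zb mxE.
exists v; split.
- by move=> b j; rewrite mxE natr_int.
- move=> i j k l /rowP/(_ ord0); rewrite !mxE -!natrD => /eqP.
  by rewrite eqr_nat; case: i j k l => [] [] [] [] //=; auto.
- move=> z [zh zint].
  have /andP[z0 z1] : 0 <= z ord0 ord0 <= 1.
    suff: conv_hull (range v) `<=` [set z | 0 <= z ord0 ord0 <= 1] by apply.
    apply: conv_hull_sub => [_ [b _ <-]|x y t t0 t1] /=.
      by rewrite mxE; case: b; rewrite /= ?lexx ?ler01.
    by rewrite !mxE; nra.
  have /intrP[k hk] := zint ord0; rewrite hk in z0 z1.
  rewrite ler0z in z0; rewrite -[1]/(1%:~R) ler_int in z1.
  have [k0|k1] : k = 0 \/ k = 1 by lia.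
    by exists false => //; rewrite -(vP z false) // hk k0.
  by exists true => //; rewrite -(vP z true) // hk k1.
- move=> A Aaff vA; apply/seteqP; split=> // z _.
  have -> : z = (1 - z ord0 ord0) *: v false + z ord0 ord0 *: v true.
    by apply/rowP => i; rewrite ord1 !mxE mulr0 add0r mulr1.
  by apply: Aaff; apply: vA; [exists false|exists true].
Qed.

(* The triangle with vertices (1,0), (0,1), (-1,-1), whose only other lattice
   point is the origin. *)
Lemma extremal_family_dim2 :
  exists v : bool * bool -> 'rV[R]_2, extremal_family v.
Proof.
(* The corners of the unit square, with (1,1) replaced by the congruent point (-1,-1). *)
pose c (p : bool * bool) (j : 'I_2) : int :=
  (if j == 0 then p.1 else p.2)%:Z - (2 * (p.1 && p.2))%:Z.
pose v p : 'rV[R]_2 := \row_j (c p j)%:~R.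
have v0 p : v p ord0 0 = (c p 0)%:~R by rewrite mxE.
have v1 p : v p ord0 1 = (c p 1)%:~R by rewrite mxE.
have rowP2 (x y : 'rV[R]_2) :
    x ord0 0 = y ord0 0 -> x ord0 1 = y ord0 1 -> x = y.
  move=> xy0 xy1; apply/rowP => -[[|[|//]] i2].
    by rewrite (_ : Ordinal i2 = 0) //; apply: val_inj.
  by rewrite (_ : Ordinal i2 = 1) //; apply: val_inj.
exists v; split.
- by move=> p j; rewrite mxE intr_int.
- move=> i j k l /rowP E.
  have cE m : c i m + c j m = c k m + c l m.
    by apply: (@intr_inj R); have := E m; rewrite !mxE !intrD.
  move: (cE 0) (cE 1); rewrite /c {cE}.
  by case: i j k l {E} => [[] []] [[] []] [[] []] [[] []] //=; auto.
- move=> z [zh zint].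
  (* One inequality for each edge of the triangle. *)
  pose tri : set 'rV[R]_2 := [set z | [/\ z ord0 0 + z ord0 1 <= 1,
    z ord0 0 - 2 * z ord0 1 <= 1 & z ord0 1 - 2 * z ord0 0 <= 1]].
  have [h1 h2 h3] : tri z.
    suff: conv_hull (range v) `<=` tri by apply.
    apply: conv_hull_sub => [_ [p _ <-]|x y t t0 t1] /=.
      by rewrite /tri /= !v0 !v1 /c; case: p => [] [] [] /=; split; lra.
    move=> [x1 x2 x3] [y1 y2 y3]; rewrite /tri /= !mxE; split; nra.
  have /intrP[a ha] := zint 0; have /intrP[b hb] := zint 1.
  rewrite ha hb in h1 h2 h3.
  have k1 : a + b <= 1 by rewrite -(ler_int R) intrD.
  have k2 : a - 2 * b <= 1 by rewrite -(ler_int R) intrB intrM.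
  have k3 : b - 2 * a <= 1 by rewrite -(ler_int R) intrB intrM.
  suff [p [pa pb]] : exists p, c p 0 = a /\ c p 1 = b.
    by exists p => //; apply: rowP2; rewrite ?v0 ?v1 ?ha ?hb ?pa ?pb.
  have : a = 0 /\ b = 0 \/ a = 1 /\ b = 0 \/ a = 0 /\ b = 1 \/
      a = -1 /\ b = -1 by lia.
  case=> [|[|[|]]] [-> ->].
  + by exists (false, false).
  + by exists (true, false).
  + by exists (false, true).
  + by exists (true, true).
- move=> A Aaff vA; apply/seteqP; split=> // z _.
  have Av p : A (v p) by apply: vA; exists p.
  (* [z] is the midpoint of its doubled projections to the axes, each on a line through the origin
     and a vertex. *)
  have -> : z = (1 - 2^-1) *:
      ((1 - 2 * z ord0 0) *: v (false, false)
        + (2 * z ord0 0) *: v (true, false))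
    + 2^-1 *:
      ((1 - 2 * z ord0 1) *: v (false, false)
        + (2 * z ord0 1) *: v (false, true)).
    by apply: rowP2; rewrite !(v0, v1, mxE) /c /=; field.
  by do 3! apply: (Aaff) => //.
Qed.

Lemma extremal_family_exists d : (0 < d)%N ->
  exists (T : finType) (v : T -> 'rV[R]_d),
    #|T| = (2 ^ d)%N /\ extremal_family v.
Proof.
case: d => // -[_|d _].
  have [v vE] := extremal_family_dim1.
  by exists bool, v; rewrite card_bool.
elim: d => [|d [T [v [cT vE]]]].
  have [v vE] := extremal_family_dim2.
  by exists (bool * bool)%type, v; rewrite card_prod card_bool.
have [w wE] := extremal_family_step vE.
by exists (bool * T)%type, w; rewrite card_prod card_bool cT -expnS.
Qed.

End Construction.

(** * From extremal families to the sharp polytope *)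

Lemma lattice_polytope_extremal (R : realType) (T : finType) d
    (v : T -> 'rV[R]_d) :
  extremal_family v -> lattice_polytope (conv_hull (range v)).
Proof.
move=> [vint _ _ vaff]; split.
  exists (codom v).
  have -> : [set` codom v] = range v.
    apply/seteqP; split=> [x /codomP[i ->]|_ [i _ <-]] /=; first by exists i.
    exact: codom_f.
  by split=> // _ [i _ <-].
exists 0, fullv; split; first by rewrite dimvf /dim /= mul1n.
have -> : affine_hull (conv_hull (range v)) = setT.
  apply/seteqP; split=> // x _ A [Aaff PA].
  rewrite (vaff A) // => y vy; apply: PA.
  exact: sub_gen_smallest.
by apply/esym/seteqP; split=> // x _; exists x; rewrite /= ?memvf ?add0r.
Qed.

Set Strict Implicit.
Unset Implicit Arguments.
Local Close Scope ring_scope.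

Theorem theorem4p3 (R : realType) (d : nat) (hd : (1 <= d)%N) :
  (forall P : set 'rV[R]_d,
     lattice_polytope P -> lattice_diam P = 1%N ->
     lattice_diam_directions P #<= `I_('C(2 ^ d, 2))) /\
  (exists P : set 'rV[R]_d,
     [/\ lattice_polytope P, lattice_diam P = 1%N
       & lattice_diam_directions P #= `I_('C(2 ^ d, 2))]).
Proof.
split; first by move=> P _; exact: card_lattice_diam_directions_le.
have [T [v [cT vE]]] := extremal_family_exists R hd.
have vI := extremal_family_inj vE; have [vint vdps vhull _] := vE.
have vP i : (conv_hull (range v) `&` @int_lattice R d) (v i).
  by split=> //; apply: sub_gen_smallest; exists i.
have dps : distinct_pair_sums (conv_hull (range v) `&` @int_lattice R d).
  move=> _ _ _ _ /vhull[i _ <-] /vhull[j _ <-] /vhull[k _ <-] /vhull[l _ <-].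
  by case/vdps => ->; [left|right].
have [i [j ij]] : exists i j : T, i != j.
  (* Two distinct points make the diameter 1 rather than 0; this uses [d >= 1]. *)
  have : (1 < #|T|)%N by rewrite cT -[1%N]/(2 ^ 0)%N ltn_exp2l.
  by case/card_gt1P => i [j [_ _ ij]]; exists i, j.
have P1 : lattice_diam (conv_hull (range v)) = 1%N.
  by apply: (lattice_diam_eq1 dps (vP i) (vP j)); rewrite (inj_eq vI).
exists (conv_hull (range v)); split=> //.
  exact: lattice_polytope_extremal.
rewrite card_eq_le card_lattice_diam_directions_le // -cT.
exact: (card_lattice_diam_directions_ge dps vI vP).
Qed.
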